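(* The quantum automorphism group of the circulant graph $C_{12}(4,5)$ is $H_2^+\times S_3$; that is, $G_{aut}^+(C_{12}(4,5))$ and $H_2^+\times S_3$ are isomorphic as compact quantum groups.
   Context: Graphs are finite, undirected, without loops and multiple edges. $C_{12}(4,5)$ is the graph with vertex set $\{1,\dots,12\}$ and $i\sim j$ iff $\min(|i-j|,12-|i-j|)\in\{1,4,5\}$. For a graph $\Gamma$ with vertex set $V$ and adjacency matrix $A$, the quantum automorphism group $G_{aut}^+(\Gamma)$ is the compact matrix quantum group whose algebra $C(G_{aut}^+(\Gamma))$ is the universal unital $C^*$-algebra generated by $u_{ij}$ ($i,j\in V$) subject to $u_{ij}=u_{ij}^*=u_{ij}^2$, $\sum_k u_{ik}=1=\sum_k u_{ki}$ for all $i$, and $Au=uA$, with comultiplication $\Delta(u_{ij})=\sum_k u_{ik}\otimes u_{kj}$. $H_2^+$ is the hyperoctahedral quantum group, which is the quantum automorphism group $G_{aut}^+(C_4)$ of the $4$-cycle $C_4$. $H_2^+\times S_3$ is the direct product: $C(H_2^+\times S_3)$ is the universal unital $C^*$-algebra generated by $v_{ij}$ ($1\le i,j\le 4$) and $w_{kl}$ ($1\le k,l\le 3$) such that all $v_{ij},w_{kl}$ are self-adjoint projections, all rows and columns of $v$ and of $w$ sum to $1$, $A_{C_4}v=vA_{C_4}$ (where $A_{C_4}$ is the adjacency matrix of $C_4$), and $v_{ij}w_{kl}=w_{kl}v_{ij}$ for all indices; the comultiplication is $\Delta(v_{ij})=\sum_a v_{ia}\otimes v_{aj}$, $\Delta(w_{kl})=\sum_b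 w_{kb}\otimes w_{bl}$. Isomorphism of compact quantum groups means a $*$-isomorphism of the algebras intertwining the comultiplications. *)

(* Defs.v *)
From HB Require Import structures.
From mathcomp Require Import all_boot all_order all_algebra complex.
From mathcomp Require Import reals.
Import Order.TTheory GRing.Theory Num.Theory.

Set Implicit Arguments.
Unset Strict Implicit.
Unset Printing Implicit Defensive.

Local Open Scope ring_scope.
Local Open Scope complex_scope.

(** * Unital C*-algebras *)

(* The C*-norm is a separate operation because MathComp's hierarchy has no
   join of [normedModType] and [algType].  An [algType] is nonzero, so the zero
   algebra is not a C*-algebra here. *)
HB.mixin Record isCStarAlgebra (R : realType) A of GRing.Algebra R[i] A := {
  star : A -> A;
  starK : involutive star;
  starD : {morph star : x y / x + y};
  starZ : forall (c : R[i]) (x : A), star (c *: x) = c^* *: star x;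
  starM : forall x y : A, star (x * y) = star y * star x;
  cnorm : A -> R;
  cnorm_eq0 : forall x : A, cnorm x = 0 -> x = 0;
  cnormZ : forall (c : R[i]) (x : A), (cnorm (c *: x))%:C = `|c| * (cnorm x)%:C;
  cnormD : forall x y : A, cnorm (x + y) <= cnorm x + cnorm y;
  cnormM : forall x y : A, cnorm (x * y) <= cnorm x * cnorm y;
  cnorm_star_mul : forall x : A, cnorm (star x * x) = cnorm x ^+ 2;
  cnorm_complete : forall u : nat -> A,
    (forall eps : R, 0 < eps -> exists N, forall m n, (N <= m)%N -> (N <= n)%N ->
       cnorm (u m - u n) < eps) ->
    exists l : A, forall eps : R, 0 < eps -> exists N, forall n, (N <= n)%N ->
       cnorm (u n - l) < eps
}.

#[short(type="cstarType")]
HB.structure Definition CStarAlgebra (R : realType) :=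
  {A of isCStarAlgebra R A & GRing.Algebra R[i] A}.

Definition cnorm_dense (R : realType) (A : cstarType R) (S : A -> Prop) : Prop :=
  forall (x : A) (eps : R), 0 < eps -> exists2 s, S s & cnorm (x - s) < eps.

Definition star_morphism (R : realType) (A B : cstarType R) (f : A -> B) : Prop :=
  [/\ linear f, monoid_morphism f & {morph f : x / star x}].

(** * Minimal tensor product *)

Section Tensor.
Variable R : realType.
Implicit Types A B T : cstarType R.

(* [i] and [j] play the roles of [x |-> x (x) 1] and [y |-> 1 (x) y], so that
   [i x * j y] stands for [x (x) y].  The last clause says that the map
   induced by [(x, y) |-> i x * j y] on the algebraic tensor product of [A] and
   [B] is injective: an algebraic tensor can be written [\sum_k a_k (x) b_k]
   with linearly independent [a_k], and is then zero iff all [b_k] are zero.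
   Hence such a triple [(T, i, j)] amounts to a C*-norm on the algebraic tensor
   product, together with a C*-algebra containing its completion. *)
Definition tensor_embedding A B T (i : A -> T) (j : B -> T) : Prop :=
  [/\ star_morphism i, star_morphism j,
      forall x y, i x * j y = j y * i x &
      forall n (a : 'I_n -> A) (b : 'I_n -> B),
        (forall c : 'I_n -> R[i],
            \sum_k c k *: a k = 0 -> forall k, c k = 0) ->
        \sum_k i (a k) * j (b k) = 0 -> forall k, b k = 0].

(* The linear span of the products [f x * g y], when [f] is linear. *)
Definition range_span (X Y : Type) T (f : X -> T) (g : Y -> T) (t : T) : Prop :=
  exists n (a : 'I_n -> X) (b : 'I_n -> Y), t = \sum_k f (a k) * g (b k).

(* The completion of the algebraic tensor product in its smallest C*-norm. *)
Definition is_min_tensor A B T (i : A -> T) (j : B -> T) : Prop :=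
  [/\ tensor_embedding i j,
      cnorm_dense (range_span i j) &
      forall T' (i' : A -> T') (j' : B -> T'), tensor_embedding i' j' ->
        forall n (a : 'I_n -> A) (b : 'I_n -> B),
          cnorm (\sum_k i (a k) * j (b k)) <= cnorm (\sum_k i' (a k) * j' (b k))].

End Tensor.

Record minTensor (R : realType) (A B : cstarType R) := MinTensor {
  tens_alg :> cstarType R;
  tens_l : A -> tens_alg;
  tens_r : B -> tens_alg;
  tensP : is_min_tensor tens_l tens_r
}.

Definition tens (R : realType) (A B : cstarType R) (T : minTensor A B)
  (x : A) (y : B) : T := tens_l T x * tens_r T y.

(** * Compact quantum groups *)

Section CompactQuantumGroup.
Variable R : realType.
Variables (A : cstarType R) (AA : minTensor A A) (D : A -> AA).

(* [(D (x) id) \o D = (id (x) D) \o D].  The triple tensor product is realized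
   as [(A (x) A) (x) A]; [leg23] is the map [y (x) z |-> 1 (x) y (x) z], and
   [DI], [ID] are [D (x) id] and [id (x) D]. *)
Definition coassociative : Prop :=
  forall (AAA : minTensor AA A) (leg23 DI ID : AA -> AAA),
    star_morphism leg23 -> star_morphism DI -> star_morphism ID ->
    (forall y z, leg23 (tens AA y z) = tens AAA (tens AA 1 y) z) ->
    (forall x y, DI (tens AA x y) = tens AAA (D x) y) ->
    (forall x y, ID (tens AA x y) = tens AAA (tens AA x 1) 1 * leg23 (D y)) ->
    DI \o D = ID \o D.

Definition cancellative : Prop :=
  cnorm_dense (range_span (tens_l AA) D) /\
  cnorm_dense (range_span (tens_r AA) D).

End CompactQuantumGroup.

(* Woronowicz's definition; [qgC G] is the algebra usually written C(G). *)
Record compactQG (R : realType) := CompactQG {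
  qgC : cstarType R;
  qgCC : minTensor qgC qgC;
  comult : qgC -> qgCC;
  comult_star_morphism : star_morphism comult;
  comultA : coassociative comult;
  comult_cancel : cancellative comult
}.

Definition qg_isomorphic (R : realType) (G H : compactQG R) : Prop :=
  exists phi : qgC G -> qgC H,
    [/\ star_morphism phi, bijective phi &
        exists phi2 : qgCC G -> qgCC H,
          [/\ star_morphism phi2,
              forall x y, phi2 (tens (qgCC G) x y)
                          = tens (qgCC H) (phi x) (phi y) &
              forall x, phi2 (comult x) = comult (phi x)]].

(* The comultiplication acts on the matrix [u] as on a fundamental
   representation. *)
Definition corepresentation (R : realType) (G : compactQG R) n
    (u : 'M[qgC G]_n) : Prop :=
  forall i j, comult (u i j) = \sum_k tens (qgCC G) (u i k) (u k j).

(** * Graphs *)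

Record sgraph n := SGraph {
  adj :> rel 'I_n;
  adj_sym : symmetric adj;
  adj_irr : irreflexive adj
}.

Definition adjacency_mx (R : nzRingType) n (e : sgraph n) : 'M[R]_n :=
  \matrix_(i, j) (e i j)%:R.

(* [S] is a set of distances on the [n]-cycle; the distance 0 is discarded.
   Vertices are numbered from 0, which does not affect the distances. *)
Definition circulant_rel n (S : seq nat) : rel 'I_n :=
  fun i j => (i != j) && (minn `|i - j|%N (n - `|i - j|%N) \in S).

Lemma circulant_sym n S : symmetric (@circulant_rel n S).
Proof. by move=> i j; rewrite /circulant_rel eq_sym distnC. Qed.

Lemma circulant_irr n S : irreflexive (@circulant_rel n S).
Proof. by move=> i; rewrite /circulant_rel eqxx. Qed.

Definition circulant n S : sgraph n :=
  SGraph (@circulant_sym n S) (@circulant_irr n S).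

Definition C12_4_5 : sgraph 12 := circulant 12 [:: 1; 4; 5]%N.

Definition C4 : sgraph 4 := circulant 4 [:: 1]%N.

(** * Quantum automorphism groups *)

Section Relations.
Variables (R : realType) (B : cstarType R).

Definition magic_unitary n (u : 'M[B]_n) : Prop :=
  [/\ forall i j, star (u i j) = u i j,
      forall i j, u i j * u i j = u i j,
      forall i, \sum_k u i k = 1 &
      forall i, \sum_k u k i = 1].

Definition qaut_rel n (e : sgraph n) (u : 'M[B]_n) : Prop :=
  magic_unitary u /\ adjacency_mx B e *m u = u *m adjacency_mx B e.

Definition H2xS3_rel (v : 'M[B]_4) (w : 'M[B]_3) : Prop :=
  [/\ qaut_rel C4 v, magic_unitary w &
      forall i j k l, v i j * w k l = w k l * v i j].

End Relations.

(* C(G) is the universal unital C*-algebra on the generators [u i j] subject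
   to the relations: it satisfies them, and any other solution in a unital
   C*-algebra is the image of [u] under a unique unital *-morphism. *)
Definition is_qaut (R : realType) n (e : sgraph n) (G : compactQG R) : Prop :=
  exists u : 'M[qgC G]_n,
    [/\ qaut_rel e u,
        forall (B : cstarType R) (u' : 'M[B]_n), qaut_rel e u' ->
          exists! f : qgC G -> B, star_morphism f /\ map_mx f u = u' &
        corepresentation u].

Definition is_H2xS3 (R : realType) (G : compactQG R) : Prop :=
  exists (v : 'M[qgC G]_4) (w : 'M[qgC G]_3),
    [/\ H2xS3_rel v w,
        forall (B : cstarType R) (v' : 'M[B]_4) (w' : 'M[B]_3),
          H2xS3_rel v' w' ->
          exists! f : qgC G -> B,
            [/\ star_morphism f, map_mx f v = v' & map_mx f w = w'],
        corepresentation v & corepresentation w].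

(* Main.v *)
Require Import Defs.
From mathcomp Require Import all_boot all_order all_algebra complex.
From mathcomp Require Import boolp reals.
From mathcomp Require Import ring lra.
Import Order.TTheory GRing.Theory Num.Theory.

(** By the Chinese remainder theorem, [x |-> (x mod 4, x mod 3)] identifies the
    vertices of C12(4,5) with Z/4 x Z/3.  The distances 1, 4, 5 become
    (+-1, +-1) and (0, +-1), so [x] and [y] are adjacent iff their classes mod 4
    are equal or adjacent in C4 and their classes mod 3 differ.  The adjacency
    matrix is therefore [M = L (x) K], with [L = 1 + A_C4] and [K = J - 1] of
    size 3, where [J] denotes an all-ones matrix.

    From [L^2 = 1 + 2J] and [K^2 = 1 + J] one gets
    [M^2 = 1 + P + 2Q + 2(J (x) J)] with [P = 1 (x) J] and [Q = J (x) 1].  A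
    magic unitary [u] commutes with [J (x) J] always; if it commutes with [M],
    it commutes with [X = P + 2Q], hence with
    [X^2 - 3X - 4(J (x) J) = 10Q], hence with [P] and [Q]: it preserves both
    partitions of the vertices, into classes mod 4 and into classes mod 3
    ([qaut_comm_fibers]).  Summing [u] over the classes of an invariant
    partition gives a smaller magic unitary ([quot_mx_magic]); call them [v]
    (size 4) and [w] (size 3).  Since two classes of different moduli meet in
    one vertex and the entries of a row of [u] are orthogonal, [v (x) w] and
    the product in the other order both equal [u] ([quot_mx_factor],
    [quot_mx_commute]), and commutation of [u] with [M P = 2 (L (x) J)] makes
    [v] commute with A_C4.  Conversely [v (x) w] solves the relations of
    C12(4,5) whenever [v], [w] solve those of H_2^+ x S_3.  The universal
    properties then give mutually inverse *-morphisms.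

    Two facts of C*-algebra theory are needed on the way.

    - Projections with sum 1 are orthogonal ([projection_sum_orthogonal]).
      This fails for idempotents of a general Banach algebra, and the proof
      rests on the unit of a corner being an extreme point of its unit ball
      ([corner_unit_extreme]).

    - A *-isomorphism [phi] of two algebras induces [phi (x) phi] on their
      minimal tensor squares ([tensor_iso]).  Minimality of the two norms makes
      the algebraic map isometric, and a densely defined isometry extends to
      the completion ([isometry_extension]). *)

Set Implicit Arguments.
Unset Strict Implicit.
Unset Printing Implicit Defensive.

Local Open Scope ring_scope.
Local Open Scope complex_scope.

(** * Norm and projections in a C*-algebra *)

Section Norm.
Variables (R : realType) (A : cstarType R).
Implicit Types x y p q : A.

Lemma cnormZr (r : R) x : cnorm (r%:C *: x) = `|r| * cnorm x.
Proof.
apply: (@complexI R); rewrite cnormZ normc_def /= expr0n addr0 sqrtr_sqr.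
by rewrite rmorphM.
Qed.

Lemma cnormN x : cnorm (- x) = cnorm x.
Proof.
have -> : - x = (-1)%:C *: x by rewrite rmorphN1 scaleN1r.
by rewrite cnormZr normrN normr1 mul1r.
Qed.

Lemma cnorm0 : cnorm (0 : A) = 0.
Proof.
rewrite -(scale0r (0 : A)) -(rmorph0 (real_complex R)).
by rewrite cnormZr normr0 mul0r.
Qed.

Lemma cnorm_ge0 x : 0 <= cnorm x.
Proof. have := cnormD x (- x); rewrite subrr cnorm0 cnormN; lra. Qed.

Lemma cnormC x y : cnorm (x - y) = cnorm (y - x).
Proof. by rewrite -cnormN opprB. Qed.

Lemma cnorm_le_eq0 x : (forall e : R, 0 < e -> cnorm x <= e) -> x = 0.
Proof.
move=> h; apply: cnorm_eq0; apply/eqP; rewrite eq_le cnorm_ge0 andbT.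
by apply/ler_addgt0Pr => e /h; rewrite add0r.
Qed.

Lemma star1 : star (1 : A) = 1.
Proof. by rewrite -[LHS]mul1r -{1}[1]starK -starM mul1r starK. Qed.

Lemma star0 : star (0 : A) = 0.
Proof. by apply: (addIr (star 0)); rewrite -starD !add0r. Qed.

Lemma starN x : star (- x) = - star x.
Proof. by apply/eqP; rewrite -addr_eq0 -starD addNr star0. Qed.

Lemma star_sum (I : Type) (r : seq I) (P : pred I) (F : I -> A) :
  star (\sum_(i <- r | P i) F i) = \sum_(i <- r | P i) star (F i).
Proof. exact: (big_morph _ (@starD _ A) star0). Qed.

Lemma cnorm_star x : cnorm (star x) = cnorm x.
Proof.
have le y : cnorm y <= cnorm (star y).
  have [->|ny] := eqVneq (cnorm y) 0; first exact: cnorm_ge0.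
  have y0 : 0 < cnorm y by rewrite lt_def ny cnorm_ge0.
  by rewrite -(ler_pM2r y0) -expr2 -cnorm_star_mul cnormM.
by apply/eqP; rewrite eq_le le -{2}(starK x) le.
Qed.

Lemma cnorm_sum_le (I : finType) (P : pred I) (F : I -> A) (b : R) :
  (forall i, P i -> cnorm (F i) <= b) -> cnorm (\sum_(i | P i) F i) <= b *+ #|P|.
Proof.
move=> h; rewrite -sumr_const.
elim/big_ind2: _ => [|x1 x2 y1 y2 h1 h2|i /h//]; first by rewrite cnorm0.
exact: le_trans (cnormD _ _) (lerD h1 h2).
Qed.

Definition projection p := star p = p /\ p * p = p.

Lemma projectionC p : projection p -> projection (1 - p).
Proof.
move=> [sp pp]; split.
  by rewrite starD star1 starN sp.
by rewrite mulrBl mul1r mulrBr mulr1 pp subrr subr0.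
Qed.

Lemma cnorm_projection p : projection p -> cnorm p <= 1.
Proof.
move=> [sp pp]; have := cnorm_star_mul p; rewrite sp pp => e.
have [->|n0] := eqVneq (cnorm p) 0; first exact: ler01.
suff -> : cnorm p = 1 by [].
by apply: (mulfI n0); rewrite mulr1 -expr2 -e.
Qed.

Lemma star_square_eq0 x : star x = x -> x * x = 0 -> x = 0.
Proof.
move=> sx xx; apply: cnorm_eq0; apply/eqP.
by rewrite -sqrf_eq0 -cnorm_star_mul sx xx cnorm0.
Qed.

(** The unit [q] of the corner [q A q] is an extreme point of its unit ball: if
    [q + x] and [q - x] are contractions then [x] squares to 0 (and so vanishes
    when self-adjoint).

    With [u = (q + x) / 2] and [v = (q - x) / 2], of norm at most 1/2, the sum
    [\sum_k 'C(n, k) (2k - n + j)^2 u^k v^(n-k)] equals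
    [(n + j^2) q + n (n - 1) x^2 + 2 j n x], because [u + v = q] and
    [u - v = x].  Its norm is at most its value at [u = v = 1/2], which is the
    second moment [n + j^2] of a simple random walk started at [j].  For [j = 0]
    this bounds [n (n - 1) x^2] by a multiple of [n].  The closed form is
    [walk], and the induction on [n] conditions on the first step of the
    random walk. *)
Section Corner.
Variables q x : A.
Hypotheses (qq : q * q = q) (qx : q * x = x) (xq : x * q = x).
Hypotheses (q1 : cnorm q <= 1) (hp : cnorm (q + x) <= 1) (hm : cnorm (q - x) <= 1).

Let walk (a b c : R) := a%:C *: q + b%:C *: (x * x) + c%:C *: x.

Let walkD a b c a' b' c' :
  walk a b c + walk a' b' c' = walk (a + a') (b + b') (c + c').
Proof.
by rewrite /walk addrACA [X in X + _ = _]addrACA !rmorphD !scalerDl.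
Qed.

Let walkN a b c : - walk a b c = walk (- a) (- b) (- c).
Proof. by rewrite /walk !rmorphN !scaleNr !opprD. Qed.

Let mulq_walk a b c : q * walk a b c = walk a b c.
Proof. by rewrite /walk !mulrDr -!scalerAr qq mulrA !qx. Qed.

Let mulx_walk a c : x * walk a 0 c = walk 0 c a.
Proof.
by rewrite /walk rmorph0 !scale0r addr0 add0r mulrDr -!scalerAr xq addrC.
Qed.

Let walk_step (a a' b c c' : R) :
  (q + x) * walk a b c + (q - x) * walk a' b c'
  = walk (a + a') (2 * b + c - c') (a - a' + c + c').
Proof.
rewrite mulrDl mulrBl !mulq_walk addrACA -mulrBr walkN !walkD subrr mulx_walk.
by rewrite walkD; congr walk; ring.
Qed.

Let cnorm_walk n (j : R) :
  cnorm (walk (n%:R + j ^+ 2) (n%:R * (n%:R - 1)) (2 * j * n%:R)) <= n%:R + j ^+ 2.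
Proof.
elim: n j => [|n IH] j.
  rewrite /walk !mul0r mulr0 rmorph0 !scale0r !addr0 add0r cnormZr.
  by rewrite ger0_norm ?sqr_ge0// ler_piMr ?sqr_ge0.
rewrite -(@ler_pM2l _ 2)// -[X in X * cnorm _](@ger0_norm _ 2)// -cnormZr.
set w := walk _ _ _.
have -> : 2%:C *: w
  = (q + x) * walk (n%:R + (j + 1) ^+ 2) (n%:R * (n%:R - 1)) (2 * (j + 1) * n%:R)
  + (q - x) * walk (n%:R + (j - 1) ^+ 2) (n%:R * (n%:R - 1)) (2 * (j - 1) * n%:R).
  rewrite walk_step /w /walk !scalerDr !scalerA -!rmorphM.
  by congr (_%:C *: _ + _%:C *: _ + _%:C *: _); rewrite -natr1; ring.
apply: le_trans (cnormD _ _) _.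
have h (y z : A) (b : R) : cnorm y <= 1 -> cnorm z <= b -> cnorm (y * z) <= b.
  move=> y1 zb; apply: le_trans (cnormM _ _) (le_trans _ zb).
  by rewrite ler_piMl ?cnorm_ge0.
apply: le_trans (lerD (h _ _ _ hp (IH _)) (h _ _ _ hm (IH _))) _.
by rewrite -natr1; lra.
Qed.

Lemma corner_unit_extreme : x * x = 0.
Proof.
have h n : n%:R * cnorm (x * x) <= 2.
  have := cnorm_walk n.+1 0; rewrite expr0n addr0 !(mulr0, mul0r) => hw.
  have n0 : 0 < n.+1%:R :> R by rewrite ltr0n.
  rewrite -(ler_pM2l n0) mulrA -natr1.
  have n0' : 0 <= (n%:R + 1) * n%:R :> R by rewrite mulr_ge0 ?ler0n// natr1.
  rewrite -[X in X * cnorm _]ger0_norm// -cnormZr.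
  have -> : ((n%:R + 1) * n%:R)%:C *: (x * x)
    = walk n.+1%:R (n.+1%:R * (n.+1%:R - 1)) 0 - n.+1%:R%:C *: q.
    rewrite /walk rmorph0 scale0r addr0 addrAC subrr add0r.
    by congr (_%:C *: _); rewrite -natr1; ring.
  apply: le_trans (cnormD _ _) _; rewrite cnormN cnormZr ger0_norm ?ler0n//.
  rewrite natr1 [leRHS]mulr_natr mulr2n; apply: lerD => //.
  by rewrite ler_piMr ?ler0n.
apply: cnorm_le_eq0 => e e0.
have /archi_boundP : 0 <= 2 / e by rewrite divr_ge0 ?ltW.
set n := Num.bound _ => hn.
have n0 : 0 < n%:R :> R by apply: le_lt_trans hn; rewrite divr_ge0 ?ltW.
rewrite -(ler_pM2l n0) (le_trans (h n))// -ler_pdivrMr// ltW//.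
Qed.

End Corner.

(** Fix [q = p j].  The elements [q - q (p k) q = q (1 - p k) q] are
    contractions, and the [q (p k) q] for [k != j] sum to 0; after division by
    the number of these [k], both [q - x] and [q + x] are averages of
    contractions when [x] is a multiple of [q (p i) q].  Extremality of [q]
    gives [q (p i) q = 0], which is the square of the norm of [p i * q]. *)
Lemma projection_sum_orthogonal (I : finType) (p : I -> A) :
  (forall i, projection (p i)) -> \sum_i p i = 1 ->
  forall i j, i != j -> p i * p j = 0.
Proof.
move=> pp sp i j nij; set q := p j.
have [sq qq] : projection q by exact: pp.
have q1 : cnorm q <= 1 by apply/cnorm_projection/pp.
pose c k := q * p k * q.
have cjq : c j = q by rewrite /c -/q !qq.
have sumc : \sum_(k | k != j) c k = 0.
  have : \sum_k c k = q by rewrite -mulr_suml -mulr_sumr sp mulr1 qq.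
  by rewrite (bigD1 j)//= cjq -[RHS]addr0 => /addrI.
have qc k : cnorm (q - c k) <= 1.
  have -> : q - c k = q * (1 - p k) * q by rewrite mulrBr mulrBl mulr1 qq.
  apply: le_trans (cnormM _ _) _; rewrite mulr_ile1 ?cnorm_ge0//.
  apply: le_trans (cnormM _ _) _; rewrite mulr_ile1 ?cnorm_ge0//.
  exact/cnorm_projection/projectionC/pp.
pose m := #|[pred k | k != j]|.
have m0 : (0 < m)%N by apply/card_gt0P; exists i.
have mR : 0 < m%:R :> R by rewrite ltr0n.
pose x := (m%:R^-1)%:C *: c i.
have scale y : cnorm (m%:R%:C *: y) <= m%:R -> cnorm y <= 1.
  by rewrite cnormZr ger0_norm ?ler0n// ger_pMr.
have mx : m%:R%:C *: x = c i.
  by rewrite /x scalerA -rmorphM divff ?gt_eqF// rmorph1 scale1r.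
have mq : m%:R%:C *: q = \sum_(k | k != j) q.
  by rewrite sumr_const -scaler_nat rmorph_nat.
have xx : x * x = 0.
  apply: (@corner_unit_extreme q) => //.
  - by rewrite /x -scalerAr /c !mulrA qq.
  - by rewrite /x -scalerAl /c -!mulrA qq.
  - apply: scale; rewrite scalerDr mx mq.
    (* [c i] is minus the sum of the other [c k]. *)
    have -> : \sum_(k | k != j) q + c i
      = q + \sum_(k | (k != j) && (k != i)) (q - c k).
      move: sumc; rewrite [X in _ -> X + _ = _](bigD1 i)//= (bigD1 i)//= => /eqP.
      rewrite addr_eq0 => /eqP ->; rewrite -addrA; congr (_ + _).
      by rewrite big_split sumrN.
    apply: le_trans (cnormD _ _) _; apply: le_trans (lerD q1 (cnorm_sum_le _)) _.
      by move=> k _; exact: qc.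
    rewrite /m (cardD1 i [pred k | k != j]) inE nij natrD lerD2l ler_nat.
    by apply/subset_leq_card/fintype.subsetP => k; rewrite !inE andbC.
  - apply: scale; rewrite scalerBr mx mq.
    have -> : \sum_(k | k != j) q - c i
      = \sum_(k | k != j) q - \sum_(k | k != j) (if k == i then c i else 0).
      congr (_ - _); rewrite -big_mkcondr /= (big_pred1 i)// => k /=.
      by rewrite andbC; case: eqP => // ->.
    rewrite -sumrB; apply: cnorm_sum_le => k _.
    by case: ifP => _; rewrite ?subr0.
have sc : star (c i) = c i by rewrite /c !starM sq (pp i).1 mulrA.
have ci : c i = 0.
  rewrite -mx (_ : x = 0) ?scaler0//; apply: star_square_eq0 xx.
  rewrite /x starZ sc; congr (_ *: _).
  exact: conjc_real.
apply: cnorm_eq0; apply/eqP; rewrite -sqrf_eq0 -cnorm_star_mul starM sq (pp i).1.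
by rewrite mulrA -[q * p i * p i]mulrA (pp i).2 -/(c i) ci cnorm0.
Qed.
End Norm.

(** * Star-morphisms and extension of densely defined isometries *)

Section StarMorphism.
Variables (R : realType) (A B : cstarType R) (f : A -> B).
Hypothesis fS : star_morphism f.

Lemma smD x y : f (x + y) = f x + f y.
Proof. by case: fS => fl _ _; rewrite -{1}[x]scale1r fl scale1r. Qed.

Lemma sm0 : f 0 = 0.
Proof. by apply: (addIr (f 0)); rewrite -smD !add0r. Qed.

Lemma smZ c x : f (c *: x) = c *: f x.
Proof. by case: fS => fl _ _; rewrite -[c *: x]addr0 fl sm0 addr0. Qed.

Lemma sm1 : f 1 = 1.
Proof. by case: fS => _ [] . Qed.

Lemma smM x y : f (x * y) = f x * f y.
Proof. by case: fS => _ [] _ fm _. Qed.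

Lemma sm_star x : f (star x) = star (f x).
Proof. by case: fS. Qed.

Lemma sm_sum (I : Type) (r : seq I) (P : pred I) (F : I -> A) :
  f (\sum_(i <- r | P i) F i) = \sum_(i <- r | P i) f (F i).
Proof. exact: (big_morph _ smD sm0). Qed.

Lemma sm_nat n : f n%:R = n%:R.
Proof. by rewrite -scaler_nat smZ sm1 scaler_nat. Qed.

Lemma sm_mulmx m n p (M : 'M_(m, n)) (N : 'M_(n, p)) :
  map_mx f (M *m N) = map_mx f M *m map_mx f N.
Proof.
apply/matrixP => i j; rewrite !mxE sm_sum; apply: eq_bigr => k _.
by rewrite !mxE smM.
Qed.

Lemma sm_inverse g : cancel f g -> cancel g f -> star_morphism g.
Proof.
move=> fK gK; split; first by move=> c x y; rewrite -{1}[x]gK -{1}[y]gK -smZ -smD fK.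
  split; first by rewrite -[in LHS]sm1 fK.
  by move=> x y; rewrite -{1}[x]gK -{1}[y]gK -smM fK.
by move=> x; rewrite -{1}[x]gK -sm_star fK.
Qed.
End StarMorphism.

Lemma sm_comp (R : realType) (A B C : cstarType R) (f : A -> B) (g : B -> C) :
  star_morphism f -> star_morphism g -> star_morphism (g \o f).
Proof.
move=> fS gS; split=> [c x y|| x] /=.
- by rewrite (smD fS) (smZ fS) (smD gS) (smZ gS).
- by split=> [|x y] /=; rewrite ?(sm1 fS) ?(sm1 gS) ?(smM fS) ?(smM gS).
- by rewrite (sm_star fS) (sm_star gS).
Qed.

Lemma sm_id (R : realType) (A : cstarType R) : star_morphism (@id A).
Proof. by split => //; split. Qed.

(** The densely defined isometry is given by its graph [D], a relation: an
    element may then have several expressions, and single-valuedness comes out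
    of the equality of norms. *)
Section Extension.
Variables (R : realType) (T T' : cstarType R) (D : T -> T' -> Prop).
Hypotheses (D_scalar : forall c, D c%:A c%:A)
  (D_add : forall s t s' t', D s s' -> D t t' -> D (s + t) (s' + t'))
  (D_mul : forall s t s' t', D s s' -> D t t' -> D (s * t) (s' * t'))
  (D_star : forall s s', D s s' -> D (star s) (star s'))
  (D_norm : forall s s', D s s' -> cnorm s' = cnorm s)
  (D_dense : cnorm_dense (fun s => exists s', D s s')).

Definition graph_closure x y := forall e : R, 0 < e ->
  exists s s', [/\ D s s', cnorm (x - s) < e & cnorm (y - s') < e].
Local Notation G := graph_closure.

Let G_D s s' : D s s' -> G s s'.
Proof. by move=> d e e0; exists s, s'; rewrite !subrr !cnorm0. Qed.

Let G_add x1 x2 y1 y2 : G x1 y1 -> G x2 y2 -> G (x1 + x2) (y1 + y2).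
Proof.
move=> h1 h2 e e0; have e2 : 0 < e / 2 by lra.
have [s1 [s1' [d1 a1 b1]]] := h1 _ e2; have [s2 [s2' [d2 a2 b2]]] := h2 _ e2.
exists (s1 + s2), (s1' + s2'); split; first exact: D_add.
  by rewrite opprD addrACA; apply: le_lt_trans (cnormD _ _) _; lra.
by rewrite opprD addrACA; apply: le_lt_trans (cnormD _ _) _; lra.
Qed.

Let approx_mul (C : cstarType R) (x y s t : C) (K d e : R) :
  cnorm x + cnorm y + 1 <= K -> d <= 1 -> d * K <= e -> 0 < d ->
  cnorm (x - s) < d -> cnorm (y - t) < d -> cnorm (x * y - s * t) < e.
Proof.
move=> hK d1 dK d0 xs yt.
have -> : x * y - s * t = x * (y - t) + (x - s) * t.
  by rewrite mulrBr mulrBl addrA subrK.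
apply: le_lt_trans (cnormD _ _) _.
have ht : cnorm t <= cnorm y + d.
  have -> : t = y - (y - t) by rewrite opprB addrC subrK.
  by apply: le_trans (cnormD _ _) _; rewrite cnormN; lra.
have := cnormM x (y - t); have := cnormM (x - s) t.
have := cnorm_ge0 x; have := cnorm_ge0 y; have := cnorm_ge0 t.
have := cnorm_ge0 (x - s); have := cnorm_ge0 (y - t).
move: (cnorm (x * _)) (cnorm (_ * t)) xs yt hK ht.
move: (cnorm x) (cnorm y) (cnorm t) (cnorm (x - s)) (cnorm (y - t)).
move=> nx ny nt a b u v ad bd hK ht b0 a0 t0 y0 x0 hv hu.
have h1 : nx * b <= nx * d by rewrite ler_wpM2l// ltW.
have h2 : a * nt <= d * nt by rewrite ler_wpM2r// ltW.
have h3 : d * nt <= d * (ny + d) by rewrite ler_pM2l.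
have h4 : d * (nx + ny + 1) <= d * K by rewrite ler_pM2l.
nra.
Qed.

Let G_mul x1 x2 y1 y2 : G x1 y1 -> G x2 y2 -> G (x1 * x2) (y1 * y2).
Proof.
move=> h1 h2 e e0.
pose K := cnorm x1 + cnorm x2 + cnorm y1 + cnorm y2 + 1.
have [px1 px2] := (cnorm_ge0 x1, cnorm_ge0 x2).
have [py1 py2] := (cnorm_ge0 y1, cnorm_ge0 y2).
have K0 : 0 < K by rewrite /K; lra.
pose d := Num.min 1 (e / K).
have d0 : 0 < d by rewrite lt_min ltr01 divr_gt0.
have dK : d * K <= e by rewrite -ler_pdivlMr// ge_min lexx orbT.
have d1 : d <= 1 by rewrite ge_min lexx.
have [s1 [s1' [e1 a1 b1]]] := h1 _ d0; have [s2 [s2' [e2 a2 b2]]] := h2 _ d0.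
exists (s1 * s2), (s1' * s2'); split; first exact: D_mul.
  by apply: (approx_mul (K := K) _ d1 dK d0 a1 a2); rewrite /K; lra.
by apply: (approx_mul (K := K) _ d1 dK d0 b1 b2); rewrite /K; lra.
Qed.

Let G_scale c x y : G x y -> G (c *: x) (c *: y).
Proof.
move=> h; rewrite -mulr_algl -[c *: y]mulr_algl.
by apply: G_mul => //; apply: G_D.
Qed.

Let G_star x y : G x y -> G (star x) (star y).
Proof.
move=> h e /h [s [s' [d a b]]]; exists (star s), (star s').
by split; [exact: D_star | |]; rewrite -starN -starD cnorm_star.
Qed.

Let G_norm x y : G x y -> cnorm y <= cnorm x.
Proof.
move=> h; apply/ler_addgt0Pr => e e0; have e2 : 0 < e / 2 by lra.
have [s [s' [d a b]]] := h _ e2.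
have h1 : cnorm y <= cnorm (y - s') + cnorm s.
  by rewrite -(D_norm d) -{1}(subrK s' y) cnormD.
have h2 : cnorm s <= cnorm (x - s) + cnorm x.
  by rewrite [X in _ <= X + _]cnormC -{1}(subrK x s) cnormD.
lra.
Qed.

Let G_fun x y z : G x y -> G x z -> y = z.
Proof.
move=> hy hz; apply/eqP; rewrite -subr_eq0; apply/eqP/cnorm_eq0/eqP.
rewrite eq_le cnorm_ge0 andbT.
have := G_norm (G_add hy (G_scale (-1) hz)).
by rewrite !scaleN1r subrr cnorm0.
Qed.

Let G_total x : exists y, G x y.
Proof.
have en n : 0 < (n.+1%:R : R)^-1 by rewrite invr_gt0.
have [s sP] : {s : nat -> T * T' & forall n,
    D (s n).1 (s n).2 /\ cnorm (x - (s n).1) < n.+1%:R^-1}.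
  apply: (choice (P := fun n p => D p.1 p.2 /\ cnorm (x - p.1) < n.+1%:R^-1)) => n.
  by have [s [s' d] h] := D_dense x (en n); exists (s, s').
have small (e : R) : 0 < e -> exists N, forall n, (N <= n)%N -> n.+1%:R^-1 < e.
  move=> e0; have /archi_boundP : 0 <= e^-1 by rewrite invr_ge0 ltW.
  set N := Num.bound _ => hN; exists N => n Nn.
  rewrite invf_plt ?posrE// (lt_le_trans hN)// ler_nat.
  exact: leq_trans Nn (leqnSn _).
have [|y yP] := @cnorm_complete _ T' (fun n => (s n).2).
  move=> e e0; have e2 : 0 < e / 2 by lra.
  have [N NP] := small _ e2; exists N => m n /NP hm /NP hn.
  have [dm /lt_trans/(_ hm) am] := sP m; have [dn /lt_trans/(_ hn) an] := sP n.
  have dd : D ((s m).1 - (s n).1) ((s m).2 - (s n).2).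
    rewrite -[- (s n).1]scaleN1r -[- (s n).2]scaleN1r -mulr_algl.
    by rewrite -[(-1) *: (s n).2]mulr_algl; apply: D_add => //; apply: D_mul.
  rewrite (D_norm dd).
  have -> : (s m).1 - (s n).1 = - (x - (s m).1) + (x - (s n).1).
    by rewrite opprB addrA subrK.
  by apply: le_lt_trans (cnormD _ _) _; rewrite cnormN; lra.
exists y => e e0; have [N1 N1P] := small _ e0; have [N2 N2P] := yP _ e0.
pose n := maxn N1 N2; have [d a] := sP n.
exists (s n).1, (s n).2; split => //.
  by apply: lt_trans a (N1P _ _); rewrite leq_maxl.
by rewrite cnormC; apply: N2P; rewrite leq_maxr.
Qed.

(** The closure of the graph [D] is again a graph: it is total since images of
    Cauchy sequences are Cauchy, single-valued since it decreases norms, and it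
    inherits the algebraic closure properties of [D] by continuity of the
    operations. *)
Lemma isometry_extension :
  exists2 F : T -> T', star_morphism F & forall s s', D s s' -> F s = s'.
Proof.
have [F FP] := choice G_total; exists F; last by move=> s s' /G_D; apply: G_fun.
split=> [c x y|| x].
- by apply: G_fun (FP _) _; apply: G_add => //; apply: G_scale.
- split=> [|x y]; last by apply: G_fun (FP _) _; apply: G_mul.
  apply: G_fun (FP _) _; apply: G_D.
  by rewrite -[X in D X]scale1r -[X in D _ X]scale1r.
- by apply: G_fun (FP _) _; apply: G_star.
Qed.
End Extension.

(** * Functoriality of the minimal tensor product *)

Section TensorIso.
Variables (R : realType) (A B : cstarType R) (TA : minTensor A A) (TB : minTensor B B).
Variable phi : A -> B.
Hypotheses (phiS : star_morphism phi) (phi_bij : bijective phi).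

Definition tsum (C : cstarType R) (T : minTensor C C) (r : seq (C * C)) : T :=
  \sum_(p <- r) tens T p.1 p.2.

Lemma tens_mul (C : cstarType R) (T : minTensor C C) x y x' y' :
  tens T x y * tens T x' y' = tens T (x * x') (y * y').
Proof.
have [[lS rS cm _] _ _] := tensP T.
rewrite /tens (smM lS) (smM rS) -!mulrA; congr (_ * _).
by rewrite [LHS]mulrA -cm -mulrA.
Qed.

Lemma tens_star (C : cstarType R) (T : minTensor C C) x y :
  star (tens T x y) = tens T (star x) (star y).
Proof.
have [[lS rS cm _] _ _] := tensP T.
by rewrite /tens starM -(sm_star lS) -(sm_star rS) -cm.
Qed.

Lemma tens_scalar (C : cstarType R) (T : minTensor C C) c : tens T c%:A 1 = c%:A.
Proof.
have [[lS rS cm _] _ _] := tensP T.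
by rewrite /tens (sm1 rS) mulr1 (smZ lS) (sm1 lS).
Qed.

Lemma tensor_embedding_comp (C C' T : cstarType R) (i j : C' -> T) (f : C -> C') :
  star_morphism f -> injective f -> tensor_embedding i j ->
  tensor_embedding (i \o f) (j \o f).
Proof.
move=> fS fI [iS jS cm li].
split; [exact: sm_comp | exact: sm_comp | by move=> x y; exact: cm |].
move=> n a b ha h k; apply: (fI); rewrite (sm0 fS).
apply: (li n (f \o a) (f \o b)) => // c hc; apply: ha; apply: fI.
by rewrite (sm0 fS) -[RHS]hc (sm_sum fS); apply: eq_bigr => l _; rewrite (smZ fS).
Qed.

(** The minimal norm lies below any other one, in particular below the one pulled
    back along [f] from the tensor square of [C']. *)
Lemma cnorm_tsum_le (C C' : cstarType R) (T : minTensor C C) (T' : minTensor C' C')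
    (f : C -> C') (r : seq (C * C)) : star_morphism f -> injective f ->
  cnorm (tsum T r) <= cnorm (tsum T' [seq (f p.1, f p.2) | p <- r]).
Proof.
move=> fS fI; have [_ _ mini] := tensP T; have [emb _ _] := tensP T'.
rewrite /tsum big_map [X in cnorm X <= _]big_tnth [X in _ <= cnorm X]big_tnth.
exact: (mini _ _ _ (tensor_embedding_comp fS fI emb) _
  (fun k => (tnth (in_tuple r) k).1) (fun k => (tnth (in_tuple r) k).2)).
Qed.

(** [cnorm_tsum_le] applied to [phi] and to its inverse makes [phi (x) phi]
    isometric on algebraic tensors. *)
Lemma tensor_iso : exists2 F : TA -> TB, star_morphism F &
  forall x y, F (tens TA x y) = tens TB (phi x) (phi y).
Proof.
pose m (p : A * A) := (phi p.1, phi p.2).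
pose D s s' := exists2 r, s = tsum TA r & s' = tsum TB (map m r).
have [psi phiK psiK] := phi_bij.
have psiS := sm_inverse phiS phiK psiK.
have [||||||F FS FD] := @isometry_extension _ TA TB D.
- move=> c; exists [:: (c%:A, 1)]; rewrite /tsum /= big_seq1 /= ?tens_scalar//.
  by rewrite (smZ phiS) (sm1 phiS) tens_scalar.
- move=> _ _ _ _ [r1 -> ->] [r2 -> ->].
  by exists (r1 ++ r2); rewrite /tsum ?map_cat big_cat.
- move=> _ _ _ _ [r1 -> ->] [r2 -> ->].
  exists [seq (p.1 * q.1, p.2 * q.2) | p <- r1, q <- r2].
    rewrite /tsum big_allpairs_dep mulr_suml; apply: eq_bigr => p _.
    by rewrite mulr_sumr; apply: eq_bigr => q _; rewrite tens_mul.
  rewrite /tsum !big_map big_allpairs_dep mulr_suml; apply: eq_bigr => p _.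
  rewrite mulr_sumr ?big_map; apply: eq_bigr => q _.
  by rewrite tens_mul /= !(smM phiS).
- move=> _ _ [r -> ->]; exists [seq (star p.1, star p.2) | p <- r].
    by rewrite /tsum star_sum big_map; apply: eq_bigr => p _; rewrite tens_star.
  rewrite /tsum star_sum !big_map; apply: eq_bigr => p _.
  by rewrite tens_star /= !(sm_star phiS).
- move=> _ _ [r -> ->]; apply/eqP; rewrite eq_le; apply/andP; split.
    have := cnorm_tsum_le TB TA (map m r) psiS (can_inj psiK).
    by rewrite -map_comp (@eq_map _ _ _ id) ?map_id// => -[x y]; rewrite /m /= !phiK.
  exact: cnorm_tsum_le phiS (can_inj phiK).
- have [_ dense _] := tensP TA; move=> x e e0.
  have [s [n [a [b ->]]] h] := dense x e e0.
  exists (\sum_k tens_l TA (a k) * tens_r TA (b k)) => //.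
  exists (tsum TB (map m [seq (a k, b k) | k <- enum 'I_n])).
  exists [seq (a k, b k) | k <- enum 'I_n] => //.
  by rewrite /tsum big_map big_enum.
by exists F => // x y; apply: FD; exists [:: (x, y)]; rewrite /tsum /= big_seq1.
Qed.
End TensorIso.

(** * Magic unitaries, their quotients and their products *)

Section Magic.
Variables (R : realType) (B : cstarType R).

Lemma magic_orthogonal N (u : 'M[B]_N) x y z : magic_unitary u ->
  y != z -> u x y * u x z = 0.
Proof.
move=> [us up ur _]; apply: (@projection_sum_orthogonal R B _ (u x)); last exact: ur.
by move=> i; split.
Qed.

(** By orthogonality, the sums of entries of one row form a Boolean algebra of
    projections. *)
Lemma magic_row_sumM N (u : 'M[B]_N) x (P Q : pred 'I_N) : magic_unitary u ->
  (\sum_(y | P y) u x y) * (\sum_(y | Q y) u x y) = \sum_(y | P y && Q y) u x y.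
Proof.
move=> mu; rewrite big_mkcondr mulr_suml; apply: eq_bigr => y _.
rewrite mulr_sumr (eq_bigr (fun z => if z == y then u x y else 0)); last first.
  move=> z _; case: eqVneq => [->|]; first by case: mu => _ ->.
  by rewrite eq_sym => /(magic_orthogonal x mu).
rewrite -big_mkcondr; case: ifP => Qy.
  by rewrite (big_pred1 y)// => z /=; case: eqVneq => [->|_]; rewrite ?andbF ?Qy.
by rewrite big_pred0// => z; case: eqVneq => [->|_]; rewrite ?andbF ?Qy.
Qed.

Lemma mulrnS_eq0 (x : B) n : x *+ n.+1 = 0 -> x = 0.
Proof.
move=> h; rewrite -[x]scale1r -(@mulVf R[i] n.+1%:R) ?pnatr_eq0//.
by rewrite -scalerA scaler_nat h scaler0.
Qed.

Lemma comm_mx_mulrn N (u X : 'M[B]_N) n : comm_mx u X -> comm_mx u (X *+ n).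
Proof.
move=> h; elim: n => [|n IH]; first exact: comm_mx0.
by rewrite mulrS; apply: comm_mxD.
Qed.

Lemma comm_mx_mulrnI N (u X : 'M[B]_N) n : comm_mx u (X *+ n.+1) -> comm_mx u X.
Proof.
have e (Y : 'M[B]_N) k :
    u *m (Y *+ k) = (u *m Y) *+ k /\ (Y *+ k) *m u = (Y *m u) *+ k.
  elim: k => [|k [IH1 IH2]]; first by rewrite mulmx0 mul0mx.
  by rewrite !mulrS mulmxDr mulmxDl IH1 IH2.
rewrite /comm_mx (e X _).1 (e X _).2 => /eqP; rewrite -subr_eq0 -mulrnBl => /eqP h.
apply/eqP; rewrite -subr_eq0; apply/eqP; move: (_ - _) h => Y /matrixP h.
apply/matrixP => i j; have := h i j; rewrite mulmxnE => /[!mxE].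
exact: mulrnS_eq0.
Qed.

(** Commuting with this matrix is what it means for a magic unitary to preserve
    the partition into fibers of [p]. *)
Definition fiber_mx N m (p : 'I_N -> 'I_m) : 'M[B]_N :=
  \matrix_(x, y) (p x == p y)%:R.

(** The section [s] of [p] chooses the row from which the sums are read off; for
    an invariant partition the choice does not matter, by [quot_mx_row]. *)
Definition quot_mx N m (p : 'I_N -> 'I_m) (s : 'I_m -> 'I_N) (u : 'M[B]_N) : 'M[B]_m :=
  \matrix_(i, j) \sum_(y | p y == j) u (s i) y.

Lemma sum_natb (I : finType) (P : pred I) (F : I -> B) :
  \sum_i F i * (P i)%:R = \sum_(i | P i) F i.
Proof.
rewrite [RHS]big_mkcond; apply: eq_bigr => i _.
by case: (P i); rewrite ?mulr1 ?mulr0.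
Qed.

Lemma sum_natbl (I : finType) (P : pred I) (F : I -> B) :
  \sum_i (P i)%:R * F i = \sum_(i | P i) F i.
Proof.
rewrite [RHS]big_mkcond; apply: eq_bigr => i _.
by case: (P i); rewrite ?mul1r ?mul0r.
Qed.

Section Quotient.
Variables (N m : nat) (p : 'I_N -> 'I_m) (s : 'I_m -> 'I_N) (u : 'M[B]_N).
Hypotheses (sK : cancel s p) (mu : magic_unitary u) (uc : comm_mx u (fiber_mx p)).
Local Notation v := (quot_mx p s u).

(** The entry [(x, z)] of the equation [u F = F u], where [F] is the fiber
    matrix. *)
Let fiber_swap x z : \sum_(y | p y == p z) u x y = \sum_(y | p y == p x) u y z.
Proof.
have /matrixP/(_ x z) := uc; rewrite !mxE.
rewrite (eq_bigr (fun y => u x y * (p y == p z)%:R)); last by move=> y _; rewrite mxE.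
rewrite [in RHS](eq_bigr (fun y => (p y == p x)%:R * u y z)); last first.
  by move=> y _; rewrite mxE eq_sym.
by rewrite (sum_natb (fun y => p y == p z)) (sum_natbl (fun y => p y == p x)).
Qed.

Lemma quot_mx_col i z : v i (p z) = \sum_(y | p y == i) u y z.
Proof. by rewrite mxE fiber_swap sK. Qed.

Lemma quot_mx_row x j : v (p x) j = \sum_(y | p y == j) u x y.
Proof. by rewrite -{1}[j]sK quot_mx_col -fiber_swap sK. Qed.

Lemma quot_mx_magic : magic_unitary v.
Proof.
have [us up ur uk] := mu; split=> [i j|i j|i|j].
- by rewrite !mxE star_sum; apply: eq_bigr.
- by rewrite !mxE magic_row_sumM//; apply: eq_bigl => y; rewrite andbb.
- rewrite -(ur (s i)) (partition_big p xpredT)//=.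
  by apply: eq_bigr => j _; rewrite mxE.
- rewrite -(uk (s j)) (partition_big p xpredT)//=.
  by apply: eq_bigr => i _; rewrite -[in LHS](sK j) quot_mx_col.
Qed.

Lemma quot_mx_comm (L : 'M[B]_m) :
  comm_mx u (\matrix_(x, y) L (p x) (p y)) -> comm_mx v L.
Proof.
move=> h; apply/matrixP => i j; set M := \matrix_(x, y) _ in h.
have <- : (u *m M) (s i) (s j) = (v *m L) i j.
  rewrite !mxE (partition_big p xpredT)//=; apply: eq_bigr => k _.
  by rewrite [v i k]mxE mulr_suml; apply: eq_bigr => y /eqP <-; rewrite mxE sK.
have <- : (M *m u) (s i) (s j) = (L *m v) i j; last by rewrite h.
rewrite !mxE (partition_big p xpredT)//=; apply: eq_bigr => k _.
rewrite -[in RHS](sK j) quot_mx_col mulr_sumr.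
by apply: eq_bigr => y /eqP <-; rewrite mxE !sK.
Qed.
End Quotient.

(** [p] and [r] identify ['I_N] with ['I_m * 'I_n], and [k] is the inverse
    bijection. *)
Section Kron.
Variables (N m n : nat) (p : 'I_N -> 'I_m) (r : 'I_N -> 'I_n).
Variable k : 'I_m -> 'I_n -> 'I_N.
Hypotheses (pk : forall i j, p (k i j) = i) (rk : forall i j, r (k i j) = j)
  (kK : forall x, k (p x) (r x) = x).

Lemma sum_pair (V : nmodType) (F : 'I_m -> 'I_n -> V) :
  \sum_x F (p x) (r x) = \sum_i \sum_j F i j.
Proof.
rewrite pair_big (reindex (fun ij : 'I_m * 'I_n => k ij.1 ij.2))/=.
  by apply: eq_bigr => -[i j] _; rewrite pk rk.
by exists (fun x => (p x, r x)) => [[i j]|x] _ /=; rewrite ?pk ?rk ?kK.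
Qed.

Definition kron (A : 'M[B]_m) (C : 'M[B]_n) : 'M[B]_N :=
  \matrix_(x, y) (A (p x) (p y) * C (r x) (r y)).

Lemma kronDl A A' C : kron (A + A') C = kron A C + kron A' C.
Proof. by apply/matrixP => x y; rewrite !mxE mulrDl. Qed.

Lemma kronDr A C C' : kron A (C + C') = kron A C + kron A C'.
Proof. by apply/matrixP => x y; rewrite !mxE mulrDr. Qed.

Lemma kronMnl A C i : kron (A *+ i) C = kron A C *+ i.
Proof. by apply/matrixP => x y; rewrite mxE !mulmxnE mxE mulrnAl. Qed.

Lemma kronMnr A C i : kron A (C *+ i) = kron A C *+ i.
Proof. by apply/matrixP => x y; rewrite mxE !mulmxnE mxE mulrnAr. Qed.

Lemma kron_mul (A A' : 'M[B]_m) (C C' : 'M[B]_n) :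
  (forall i j i' j', C i j * A' i' j' = A' i' j' * C i j) ->
  kron A C *m kron A' C' = kron (A *m A') (C *m C').
Proof.
move=> cm; apply/matrixP => x y; rewrite !mxE.
rewrite mulr_suml.
transitivity (\sum_z (A (p x) (p z) * A' (p z) (p y)) *
                     (C (r x) (r z) * C' (r z) (r y))).
  by apply: eq_bigr => z _; rewrite !mxE -!mulrA; congr (_ * _); rewrite !mulrA cm.
rewrite (sum_pair (fun i j =>
  (A (p x) i * A' i (p y)) * (C (r x) j * C' j (r y)))).
by apply: eq_bigr => i _; rewrite mulr_sumr.
Qed.

Lemma kron_magic (v : 'M[B]_m) (w : 'M[B]_n) :
  magic_unitary v -> magic_unitary w ->
  (forall i j i' j', v i j * w i' j' = w i' j' * v i j) ->
  magic_unitary (kron v w).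
Proof.
move=> [vs vp vr vc] [ws wp wr wc] cm; split=> [x y|x y|x|y].
- by rewrite mxE starM vs ws cm.
- by rewrite mxE {2}cm mulrA -[_ * w _ _ * w _ _]mulrA wp -mulrA -cm mulrA vp.
- under eq_bigr do rewrite mxE.
  rewrite (sum_pair (fun i j => v (p x) i * w (r x) j)).
  by under eq_bigr do rewrite -mulr_sumr wr mulr1; apply: vr.
- under eq_bigr do rewrite mxE.
  rewrite (sum_pair (fun i j => v i (p y) * w j (r y))).
  by under eq_bigr do rewrite -mulr_sumr wc mulr1; apply: vc.
Qed.

Section Factor.
Variable u : 'M[B]_N.
Variables (s : 'I_m -> 'I_N) (t : 'I_n -> 'I_N).
Hypotheses (sK : cancel s p) (tK : cancel t r).
Hypotheses (mu : magic_unitary u).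
Hypotheses (up : comm_mx u (fiber_mx p)) (ur : comm_mx u (fiber_mx r)).
Local Notation v := (quot_mx p s u).
Local Notation w := (quot_mx r t u).

Let fiber_pair y : (fun z => (p z == p y) && (r z == r y)) =1 pred1 y.
Proof.
move=> z /=; apply/andP/eqP => [[/eqP e1 /eqP e2]|->//].
by rewrite -[z]kK e1 e2 kK.
Qed.

(** A fiber of [p] and a fiber of [r] meet in one point, so the product of the
    two row sums reduces to one entry of [u]. *)
Lemma quot_mx_factor : u = kron v w.
Proof.
apply/matrixP => x y; rewrite mxE (quot_mx_row sK up) (quot_mx_row tK ur).
by rewrite magic_row_sumM// (eq_bigl _ _ (fiber_pair y)) big_pred1_eq.
Qed.

(** Both entries are sums over the row [k i i'] of [u], and such sums commute. *)
Lemma quot_mx_commute i j i' j' : v i j * w i' j' = w i' j' * v i j.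
Proof.
have -> : v i j = \sum_(y | p y == j) u (k i i') y.
  by rewrite -(quot_mx_row sK up) pk.
have -> : w i' j' = \sum_(y | r y == j') u (k i i') y.
  by rewrite -(quot_mx_row tK ur) rk.
rewrite !magic_row_sumM//.
by apply: eq_bigl => z; rewrite andbC.
Qed.
End Factor.

Lemma kron_quotl (v : 'M[B]_m) (w : 'M[B]_n) s : cancel s p -> magic_unitary w ->
  quot_mx p s (kron v w) = v.
Proof.
move=> sK [_ _ wr _]; apply/matrixP => i j; rewrite mxE big_mkcond /=.
under eq_bigr do rewrite mxE sK.
rewrite (sum_pair (fun i' j' => if i' == j then v i i' * w (r (s i)) j' else 0)).
rewrite (bigD1 j)//= [X in _ + X]big1 ?addr0 => [|i' /negbTE ->];
  last by rewrite big1.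
by rewrite eqxx -mulr_sumr wr mulr1.
Qed.

Lemma kron_quotr (v : 'M[B]_m) (w : 'M[B]_n) t : cancel t r -> magic_unitary v ->
  quot_mx r t (kron v w) = w.
Proof.
move=> tK [_ _ vr _]; apply/matrixP => i j; rewrite mxE big_mkcond /=.
under eq_bigr do rewrite mxE tK.
rewrite (sum_pair (fun i' j' => if j' == j then v (p (t i)) i' * w i j' else 0)).
rewrite exchange_big (bigD1 j)//= [X in _ + X]big1 ?addr0 => [|i' /negbTE ->];
  last by rewrite big1.
by rewrite eqxx -mulr_suml vr mul1r.
Qed.
End Kron.
End Magic.

(** * The product structure of C12(4,5) *)

Definition mod4 (x : 'I_12) : 'I_4 := Ordinal (ltn_pmod x (isT : 0 < 4)%N).
Definition mod3 (x : 'I_12) : 'I_3 := Ordinal (ltn_pmod x (isT : 0 < 3)%N).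

(** 9 is 1 mod 4 and 0 mod 3, while 4 is 0 mod 4 and 1 mod 3. *)
Definition crt (i : 'I_4) (j : 'I_3) : 'I_12 :=
  Ordinal (ltn_pmod (9 * i + 4 * j) (isT : 0 < 12)%N).

Lemma ord_all_iota n (P : pred nat) : all P (iota 0 n) -> forall i : 'I_n, P i.
Proof. by move=> /allP h i; apply: h; rewrite mem_iota ltn_ord. Qed.

Lemma ord_all_iota2 m n (P : nat -> pred nat) :
  all (fun i => all (P i) (iota 0 n)) (iota 0 m) ->
  forall (i : 'I_m) (j : 'I_n), P i j.
Proof. by move=> /ord_all_iota h i; apply: ord_all_iota (h i). Qed.

Lemma mod4_crt i j : mod4 (crt i j) = i.
Proof.
apply/val_inj/eqP; move: i j.
exact: (@ord_all_iota2 _ _ (fun i j => (9 * i + 4 * j) %% 12 %% 4 == i)%N).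
Qed.

Lemma mod3_crt i j : mod3 (crt i j) = j.
Proof.
apply/val_inj/eqP; move: i j.
exact: (@ord_all_iota2 _ _ (fun i j => (9 * i + 4 * j) %% 12 %% 3 == j)%N).
Qed.

Lemma crt_mod x : crt (mod4 x) (mod3 x) = x.
Proof.
apply/val_inj/eqP; move: x.
exact: (@ord_all_iota _ (fun x => (9 * (x %% 4) + 4 * (x %% 3)) %% 12 == x)%N).
Qed.

Definition loop4 : rel 'I_4 := fun i j => (i == j) || C4 i j.

Lemma C12_4_5E x y : C12_4_5 x y =
  loop4 (mod4 x) (mod4 y) && (mod3 x != mod3 y).
Proof.
apply/eqP; rewrite /loop4 /= /circulant_rel -!val_eqE /=; move: x y.
pose d n x y := minn `|x - y| (n - `|x - y|).
apply: (@ord_all_iota2 _ _ (fun x y =>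
  ((x != y) && (d 12 x y \in [:: 1; 4; 5])) ==
  ((x %% 4 == y %% 4) ||
   (x %% 4 != y %% 4) && (d 4 (x %% 4) (y %% 4) \in [:: 1]))
  && (x %% 3 != y %% 3))%N).
by vm_compute.
Qed.

(** Two distinct vertices of the 4-cycle with loops have two common neighbours, and a
    vertex has three: only the opposite vertex is missing from its row. *)
Lemma loop4_paths i j : (\sum_k loop4 i k * loop4 k j)%N = ((i == j) + 2)%N.
Proof.
rewrite !big_ord_recl big_ord0.
by case: i => -[|[|[|[|//]]]] ?; case: j => -[|[|[|[|//]]]] ?.
Qed.

Section Matrices.
Variables (R : realType) (B : cstarType R).

Definition nat_mx m n (f : 'I_m -> 'I_n -> nat) : 'M[B]_(m, n) :=
  \matrix_(i, j) (f i j)%:R.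

Lemma nat_mx_mul m n l (f : 'I_m -> 'I_n -> nat) (g : 'I_n -> 'I_l -> nat) :
  nat_mx f *m nat_mx g = nat_mx (fun i j => \sum_k f i k * g k j)%N.
Proof.
apply/matrixP => i j; rewrite !mxE natr_sum; apply: eq_bigr => k _.
by rewrite !mxE natrM.
Qed.

Lemma nat_mx_comm m n m' n' (f : 'I_m -> 'I_n -> nat) (A : 'M[B]_(m', n')) i j i' j' :
  nat_mx f i j * A i' j' = A i' j' * nat_mx f i j.
Proof. by rewrite mxE; apply/esym/commr_nat. Qed.

Local Notation L := (nat_mx loop4).
Local Notation K := (nat_mx (fun i j : 'I_3 => i != j)).
Local Notation J := (const_mx (1 : B)).
Local Notation kr := (@kron R B 12 4 3 mod4 mod3).

Let krM (A A' : 'M[B]_4) (C C' : 'M[B]_3) :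
  (forall i j i' j', C i j * A' i' j' = A' i' j' * C i j) ->
  kr A C *m kr A' C' = kr (A *m A') (C *m C').
Proof. exact: kron_mul mod4_crt mod3_crt crt_mod _ _ _ _. Qed.

Lemma adjacency_C12_4_5 : adjacency_mx B C12_4_5 = kr L K.
Proof. by apply/matrixP => x y; rewrite !mxE C12_4_5E -natrM mulnb. Qed.

Lemma loop4E : L = 1%:M + adjacency_mx B C4.
Proof.
apply/matrixP => i j; rewrite !mxE /loop4; case: eqP => [->|_]; last by rewrite add0r.
by rewrite adj_irr addr0.
Qed.

Lemma loop4_sqr : L *m L = 1%:M + J *+ 2.
Proof.
rewrite nat_mx_mul; apply/matrixP => i j; rewrite mxE loop4_paths natrD.
by rewrite !(mxE, mulmxnE).
Qed.

Lemma nonid3E : K = J - 1%:M.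
Proof.
by apply/matrixP => i j; rewrite !mxE; case: eqP; rewrite /= ?subrr ?subr0.
Qed.

Lemma allones_mul m n l : (J : 'M[B]_(m, n)) *m (J : 'M[B]_(n, l)) = J *+ n.
Proof.
apply/matrixP => i j; rewrite mulmxnE !mxE.
by under eq_bigr do rewrite !mxE mulr1; rewrite sumr_const card_ord.
Qed.

Lemma nonid3_sqr : K *m K = J + 1%:M.
Proof.
rewrite nonid3E mulmxBl !mulmxBr !mulmx1 !mul1mx allones_mul mulrSr mulr2n.
by rewrite opprB addrA addrAC addrK addrK.
Qed.

Lemma nonid3_allones : K *m J = J *+ 2 :> 'M_3.
Proof. by rewrite nonid3E mulmxBl mul1mx allones_mul mulrSr addrK. Qed.

Lemma kron11 : kr 1%:M 1%:M = 1%:M.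
Proof.
apply/matrixP => x y; rewrite !mxE -natrM mulnb; congr (nat_of_bool _)%:R.
apply/andP/eqP => [[/eqP e1 /eqP e2]|->//].
by rewrite -(crt_mod x) e1 e2 crt_mod.
Qed.

Lemma kronJJ : kr J J = J.
Proof. by apply/matrixP => x y; rewrite !mxE mulr1. Qed.

Lemma fiber_mod4 : fiber_mx B mod4 = kr 1%:M J.
Proof. by apply/matrixP => x y; rewrite !mxE mulr1. Qed.

Lemma fiber_mod3 : fiber_mx B mod3 = kr J 1%:M.
Proof. by apply/matrixP => x y; rewrite !mxE mul1r. Qed.

Lemma comm_magic_allones N (u : 'M[B]_N) : magic_unitary u -> comm_mx u J.
Proof.
move=> [_ _ ur uc]; apply/matrixP => i j; rewrite !mxE.
under eq_bigr do rewrite mxE mulr1.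
by under [RHS]eq_bigr do rewrite mxE mul1r; rewrite ur uc.
Qed.

Lemma comm1_entries n n' (A : 'M[B]_n) i j i' j' :
  (1%:M : 'M[B]_n') i j * A i' j' = A i' j' * (1%:M : 'M[B]_n') i j.
Proof. by rewrite mxE; apply/esym/commr_nat. Qed.

Lemma commJ_entries n n' (A : 'M[B]_n) i j i' j' :
  (J : 'M[B]_n') i j * A i' j' = A i' j' * (J : 'M[B]_n') i j.
Proof. by rewrite mxE mul1r mulr1. Qed.

Section Invariants.
Variable u : 'M[B]_12.
Hypothesis uP : qaut_rel C12_4_5 u.
Let mu : magic_unitary u := uP.1.
Let uM : comm_mx u (kr L K).
Proof. by rewrite -adjacency_C12_4_5 /comm_mx uP.2. Qed.
Let uJ : comm_mx u (kr J J).
Proof. by rewrite kronJJ; apply: comm_magic_allones. Qed.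

(** The square of the adjacency matrix counts common neighbours, which
    distinguishes pairs equal mod 4 from pairs equal mod 3.  It yields
    [P + 2 Q]; one more squaring separates [P] from [Q]. *)
Lemma qaut_comm_fibers :
  comm_mx u (fiber_mx B mod4) /\ comm_mx u (fiber_mx B mod3).
Proof.
rewrite fiber_mod4 fiber_mod3; set P := kr 1%:M J; set Q := kr J 1%:M.
have M2 : kr L K *m kr L K = P + 1%:M + (kr J J + Q) *+ 2.
  rewrite krM; last by move=> *; apply: nat_mx_comm.
  rewrite loop4_sqr nonid3_sqr kronDl kronMnl !kronDr mulrnDl.
  by rewrite kron11.
have c1 : comm_mx u (P + Q *+ 2).
  have := comm_mxB (comm_mxB (comm_mxM uM uM) (comm_mx1 u)) (comm_mx_mulrn 2 uJ).
  rewrite M2; congr comm_mx; rewrite mulrnDl (addrAC _ _ (- 1%:M)) addrK.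
  by rewrite (addrC (_ *+ 2)) addrA addrK.
have X2 : (P + Q *+ 2) *m (P + Q *+ 2)
    = (P + Q *+ 2) *+ 3 + kr J J *+ 4 + Q *+ 10.
  have PP : P *m P = P *+ 3.
    by rewrite krM ?mulmx1 ?allones_mul ?kronMnr// => *; apply: commJ_entries.
  have QQ : Q *m Q = Q *+ 4.
    by rewrite krM ?mulmx1 ?allones_mul ?kronMnl// => *; apply: comm1_entries.
  have PQ : P *m Q = kr J J.
    by rewrite krM ?mulmx1 ?mul1mx// => *; apply: commJ_entries.
  have QP : Q *m P = kr J J.
    by rewrite krM ?mulmx1 ?mul1mx// => *; apply: comm1_entries.
  move: PP QQ PQ QP; rewrite !mulmxE => PP QQ PQ QP.
  rewrite mulrDl !mulrDr !mulrnAl PP QQ PQ QP -!mulrnDr -!mulrnA addrA.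
  rewrite -mulr2n -(addrA (P *+ 3)) -mulrnDr mulrnDl -mulrnA.
  by rewrite (addrAC (P *+ 3) (Q *+ _)) -[RHS]addrA -mulrnDr.
have uQ : comm_mx u Q.
  apply: (@comm_mx_mulrnI _ _ _ _ _ 9).
  have := comm_mxB (comm_mxB (comm_mxM c1 c1) (comm_mx_mulrn 3 c1))
                   (comm_mx_mulrn 4 uJ).
  rewrite X2 !(addrAC _ (Q *+ 10)) (addrAC (_ *+ 3)).
  by rewrite subrr add0r subrr add0r.
by split=> //; have := comm_mxB c1 (comm_mx_mulrn 2 uQ); rewrite addrK.
Qed.

(** The product of [L (x) K] and [P = 1 (x) J] is [2 (L (x) J)], as [K J = 2 J]. *)
Lemma qaut_comm_loops : comm_mx u (kr L J).
Proof.
apply: (@comm_mx_mulrnI _ _ _ _ _ 1).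
have := comm_mxM uM qaut_comm_fibers.1; rewrite fiber_mod4 krM; last first.
  by move=> *; apply: nat_mx_comm.
by rewrite mulmx1 nonid3_allones kronMnr.
Qed.

End Invariants.

Definition sect4 (i : 'I_4) : 'I_12 := crt i ord0.
Definition sect3 (j : 'I_3) : 'I_12 := crt ord0 j.

Lemma sect4K : cancel sect4 mod4. Proof. by move=> i; apply: mod4_crt. Qed.
Lemma sect3K : cancel sect3 mod3. Proof. by move=> i; apply: mod3_crt. Qed.

Lemma qaut_factor (u : 'M[B]_12) : qaut_rel C12_4_5 u ->
  H2xS3_rel (quot_mx mod4 sect4 u) (quot_mx mod3 sect3 u) /\
  u = kr (quot_mx mod4 sect4 u) (quot_mx mod3 sect3 u).
Proof.
move=> uP; have [mu _] := uP; have [u4 u3] := qaut_comm_fibers uP.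
have m4 := quot_mx_magic sect4K mu u4; have m3 := quot_mx_magic sect3K mu u3.
split; last exact: quot_mx_factor crt_mod _ _ _ sect4K sect3K mu u4 u3.
split=> //; last first.
  exact: quot_mx_commute mod4_crt mod3_crt _ _ _ sect4K sect3K mu u4 u3.
split=> //; apply: comm_mx_sym.
have cL : comm_mx (quot_mx mod4 sect4 u) L.
  apply: (quot_mx_comm sect4K u4); have := qaut_comm_loops uP.
  by congr comm_mx; apply/matrixP => x y; rewrite !mxE mulr1.
by have := comm_mxB cL (comm_mx1 _); rewrite loop4E addrC addKr.
Qed.

Lemma kron_qaut (v : 'M[B]_4) (w : 'M[B]_3) :
  H2xS3_rel v w -> qaut_rel C12_4_5 (kr v w).
Proof.
move=> [[mv vA] mw cm]; split.
  by apply: (kron_magic mod4_crt mod3_crt crt_mod).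
rewrite adjacency_C12_4_5 krM; last by move=> *; rewrite nat_mx_comm.
rewrite krM; last by move=> *; rewrite nat_mx_comm.
have -> : L *m v = v *m L by rewrite loop4E mulmxDl mulmxDr mul1mx mulmx1 vA.
by rewrite nonid3E mulmxBl mulmxBr mul1mx mulmx1 (comm_magic_allones mw).
Qed.

End Matrices.

(** * Images under star-morphisms and comultiplications *)

Section Transport.
Variables (R : realType) (B C : cstarType R) (f : B -> C).
Hypothesis fS : star_morphism f.

Lemma sm_magic n (u : 'M[B]_n) : magic_unitary u -> magic_unitary (map_mx f u).
Proof.
move=> [us up ur uc]; split=> [i j|i j|i|j].
- by rewrite !mxE -(sm_star fS) us.
- by rewrite !mxE -(smM fS) up.
- by under eq_bigr do rewrite mxE; rewrite -(sm_sum fS) ur (sm1 fS).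
- by under eq_bigr do rewrite mxE; rewrite -(sm_sum fS) uc (sm1 fS).
Qed.

Lemma sm_qaut n (e : sgraph n) (u : 'M[B]_n) :
  qaut_rel e u -> qaut_rel e (map_mx f u).
Proof.
move=> [mu uA]; split; first exact: sm_magic.
have <- : map_mx f (adjacency_mx B e) = adjacency_mx C e.
  by apply/matrixP => i j; rewrite !mxE (sm_nat fS).
by rewrite -!(sm_mulmx fS) uA.
Qed.

Lemma sm_kron N m n (p : 'I_N -> 'I_m) (r : 'I_N -> 'I_n) v w :
  map_mx f (kron p r v w) = kron p r (map_mx f v) (map_mx f w).
Proof. by apply/matrixP => x y; rewrite !mxE (smM fS). Qed.

Lemma sm_quot_mx N m (p : 'I_N -> 'I_m) s u :
  map_mx f (quot_mx p s u) = quot_mx p s (map_mx f u).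
Proof.
apply/matrixP => i j; rewrite !mxE (sm_sum fS).
by apply: eq_bigr => y _; rewrite mxE.
Qed.
End Transport.

Lemma kron_corepresentation (R : realType) (H : compactQG R)
    (v : 'M[qgC H]_4) (w : 'M[qgC H]_3) :
  corepresentation v -> corepresentation w ->
  corepresentation (kron mod4 mod3 v w).
Proof.
move=> vC wC x y; rewrite mxE (smM (comult_star_morphism H)) vC wC.
under [RHS]eq_bigr do rewrite !mxE -tens_mul.
rewrite (sum_pair mod4_crt mod3_crt crt_mod (fun i j =>
  tens (qgCC H) (v (mod4 x) i) (v i (mod4 y)) *
  tens (qgCC H) (w (mod3 x) j) (w j (mod3 y)))).
by rewrite mulr_suml; apply: eq_bigr => i _; rewrite mulr_sumr.
Qed.

(** The identities [g \o f = id], [f \o g = id] and the compatibility with the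
    comultiplications are equalities of morphisms out of a universal algebra, so
    each is checked on generators only. *)
Theorem proposition7p1 (R : realType) (G H : compactQG R)
  (hG : is_qaut C12_4_5 G) (hH : is_H2xS3 H) :
  qg_isomorphic G H.
Proof.
case: hG => u [uP uU uC]; case: hH => v [w [vwP vwU vC wC]].
have [_ mw _] := vwP; have [[mv _] _ _] := vwP.
have [v'w'P uE] := qaut_factor uP.
set v' := quot_mx mod4 sect4 u in v'w'P uE; set w' := quot_mx _ _ u in v'w'P uE.
have [f [[fS fu] _]] := uU _ _ (kron_qaut vwP).
have [g [[gS gv gw] _]] := vwU _ _ _ v'w'P.
have gf : g \o f = id.
  have [h [_ hU]] := uU _ _ uP.
  rewrite -(hU (g \o f)); last first.
    by split; [exact: sm_comp|rewrite map_mx_comp fu (sm_kron gS) gv gw -uE].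
  by apply: hU; split; [exact: sm_id | rewrite map_mx_id].
have fg : f \o g = id.
  have [h [_ hU]] := vwU _ _ _ vwP.
  rewrite -(hU (f \o g)); last first.
    split; first exact: sm_comp.
      rewrite map_mx_comp gv (sm_quot_mx fS) fu.
      exact: kron_quotl mod4_crt mod3_crt crt_mod _ _ _ sect4K mw.
    rewrite map_mx_comp gw (sm_quot_mx fS) fu.
    exact: kron_quotr mod4_crt mod3_crt crt_mod _ _ _ sect3K mv.
  by apply: hU; split; [exact: sm_id | rewrite map_mx_id..].
have f_bij : bijective f.
  exists g => x; first by have /(congr1 (@^~ x)) := gf.
  by have /(congr1 (@^~ x)) := fg.
have [F FS FE] := tensor_iso (qgCC G) (qgCC H) fS f_bij.
exists f; split=> //; exists F; split=> // x.
have DS := comult_star_morphism.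
have [h [_ hU]] := uU _ _ (sm_qaut (sm_comp (DS _ G) FS) uP).
have : F \o @comult _ G = @comult _ H \o f; last by move/(congr1 (@^~ x)).
rewrite -(hU (F \o @comult _ G)); last by split=> //; exact: sm_comp (DS _ G) FS.
apply: hU; split; first exact: sm_comp fS (DS _ H).
apply/matrixP => i j; rewrite !mxE /= uC.
have fuE a b : f (u a b) = kron mod4 mod3 v w a b by rewrite -fu mxE.
rewrite fuE (kron_corepresentation vC wC) (sm_sum FS).
by apply: eq_bigr => k _; rewrite FE !fuE.
Qed.
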